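(* Let $f=h+\overline{g}$ be a sense-preserving harmonic mapping in the upper half-plane $\mathbb{H}=\{z\in\mathbb{C}:\operatorname{Im} z>0\}$, with $h,g$ analytic in $\mathbb{H}$, such that $|f(z)|<1$ for all $z\in\mathbb{H}$. Let $\{b_k\}$ be a sequence of points in $\mathbb{H}$ such that $f(b_k)=0$ for all $k$ and $\lim_{k\to\infty}b_k=0$. If $$\lim_{k\to\infty}\left(\frac{10-\operatorname{Im} b_k}{10+\operatorname{Im} b_k}\right)^{\mu(b_k,f)}=0,$$ where $\mu(b_k,f)$ denotes the multiplicity of the zero of $f$ at $b_k$, then $f\equiv0$ in $\mathbb{H}$.
   Context: A harmonic mapping is a complex-valued function $f=u+iv$ with $u,v$ real harmonic; on a simply connected domain it is written $f=h+\overline g$ with $h,g$ analytic. It is sense-preserving if its second complex dilatation $a_f=\overline{f_{\overline z}}/f_z=g'/h'$ is an analytic function with $|a_f|<1$; that is, $g'=a\,h'$ for some analytic function $a$ on the domain with $|a|<1$ (isolated zeros of $h'$ are allowed, so that zeros of $f$ may have multiplicity greater than one). If $f\equiv 0$ the conclusion holds trivially. Multiplicity of a zero: let $f(z_0)=0$ and choose the additive constants in the decomposition $f=h+\overline g$ so that $h(z_0)=g(z_0)=0$. Let $n$ and $m$ be the orders of the zeros at $z_0$ of the analytic functions $h$ and $g$ respectively (with the order being $\infty$ for a function that is identically zero); for sense-preserving $f$ one has $n\le m$. Then $\mu(z_0,f)=n$. *)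

(* Defs.v *)
From Stdlib Require Import Reals.
From Coquelicot Require Import Coquelicot.

Open Scope R_scope.

Definition upper_half_plane (z : C) : Prop := 0 < Im z.

(* The coefficients [a] give a power series expansion of [f] on some disc
   centred at [z0]. *)
Definition has_expansion (f : C -> C) (z0 : C) (a : nat -> C) : Prop :=
  exists r : R, 0 < r /\
    forall w : C, Cmod (w - z0)%C < r ->
      is_pseries (K := C_AbsRing) (V := C_NormedModule) a (w - z0)%C (f w).

Definition analytic_on (D : C -> Prop) (f : C -> C) : Prop :=
  forall z : C, D z -> exists a : nat -> C, has_expansion f z a.

(* [f = h + conj g] with [h] and [g] analytic; on a simply connected [D] these
   [f] are exactly the harmonic mappings, and [h], [g] are unique up to additive
   constants. *)
Definition harmonic_decomposition (D : C -> Prop) (f h g : C -> C) : Prop :=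
  analytic_on D h /\ analytic_on D g /\
  forall z : C, D z -> f z = (h z + Cconj (g z))%C.

(* Stated as [g' = a h'] rather than [a = g' / h'], so that [h'] may have zeros. *)
Definition sense_preserving (D : C -> Prop) (h g : C -> C) : Prop :=
  exists a : C -> C,
    analytic_on D a /\
    (forall z : C, D z -> Cmod (a z) < 1) /\
    (forall z : C, D z -> C_derive g z = (a z * C_derive h z)%C).

(* Orders and multiplicities are extended naturals; [None] is infinity. *)
Definition zero_order (D : C -> Prop) (h : C -> C) (z0 : C) (n : option nat)
  : Prop :=
  match n with
  | Some n => exists a : nat -> C,
      has_expansion h z0 a /\
      (forall k : nat, (k < n)%nat -> a k = RtoC 0) /\ a n <> RtoC 0
  | None => forall z : C, D z -> h z = RtoC 0
  end.

(* [multiplicity D f z0 n] means [mu (z0, f) = n], for a sense-preserving [f]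
   vanishing at [z0]: [n] is the order of [h], which is then at most that of
   [g]. The decomposition is the one normalized at [z0]. *)
Definition multiplicity (D : C -> Prop) (f : C -> C) (z0 : C) (n : option nat)
  : Prop :=
  exists h g : C -> C,
    harmonic_decomposition D f h g /\
    h z0 = RtoC 0 /\ g z0 = RtoC 0 /\
    zero_order D h z0 n.

(* Meant for [Rabs q < 1], where [q ^ n] tends to [0] as [n] tends to infinity. *)
Definition extended_pow (q : R) (n : option nat) : R :=
  match n with
  | Some n => q ^ n
  | None => 0
  end.

(* Main.v *)
Require Import Defs.
From Stdlib Require Import Reals Lra Lia List Classical ClassicalEpsilon.
From Coquelicot Require Import Coquelicot.

Open Scope R_scope.

(** Let [b] be a zero of [f] of multiplicity [n], and let [f = h + conj g] be
    the decomposition with [h b = g b = 0]. Since [g' = a h'] with [a] bounded,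
    [g] vanishes at [b] to order at least [n] as well
    ([zero_order_transfer]). Hence the analytic functions [h + g] and
    [- i (h - g)] vanish at [b] to order at least [n], and their real parts are
    [Re f] and [Im f], which are less than 1.

    An analytic function [F] on the half-plane with [Re F < 1] satisfies
    [|F / (2 - F)| < 1], so if it vanishes to order [n] at [b], Schwarz's lemma
    gives [|F / (2 - F)| <= r ^ n] where [r = |z - b| / |z - conj b|]
    ([half_plane_schwarz]). With [s = Re (F z)] this yields
    [|s| <= (2 + |s|) r ^ n], a bound in which the additive constants of [h]
    and [g] no longer appear.

    For fixed [z] and small [b], [1 - r ^ 2] is at least a fixed multiple of
    [Im b], so some fixed power of [r] is at most
    [(10 - Im b) / (10 + Im b)] ([reflect_ratio_pow_le]). If [f z] were not
    zero, then [r ^ n] would stay above a positive constant along the zeros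
    [b_k], hence so would the [mu_k]-th power of
    [(10 - Im b_k) / (10 + Im b_k)], contrary to the hypothesis.

    Both [half_plane_schwarz] and the bound on derivatives that
    [zero_order_transfer] uses come from the maximum principle, which is proved
    here without integration: if [q] is the sum of the values of [Q] at
    [z + t], [z - t], [z + i t] and [z - i t], then [q = 4 Q z + O(t ^ 3)], and
    this is incompatible with a local maximum of [|Q| ^ 2 + e |z| ^ 2] at [z]
    for [e > 0] ([no_local_max]). *)

(** * Iterated difference quotients *)

Lemma Cmod_minus_sym (x y : C) : Cmod (x - y) = Cmod (y - x).
Proof. rewrite <- Cmod_opp. f_equal. ring. Qed.

Lemma Cminus_neq_0 (x y : C) : x <> y -> (x - y)%C <> RtoC 0.
Proof. intros Hxy H. apply Hxy. replace x with (x - y + y)%C by ring. rewrite H. ring. Qed.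

Lemma locally_Cmod (z : C) (P : C -> Prop) :
  locally z P <-> exists d : R, 0 < d /\ forall x : C, Cmod (x - z) < d -> P x.
Proof.
  split.
  - intros H.
    destruct (locally_norm_le_locally (V := C_NormedModule) z P H) as [d Hd].
    exists d; split; [apply cond_pos|]. intros x Hx. apply Hd, Hx.
  - intros [d [Hd H]].
    apply (locally_le_locally_norm (V := C_NormedModule) z P).
    exists (mkposreal d Hd). intros x Hx. apply H, Hx.
Qed.

(** [taylor k f z] is a Taylor expansion of order [k] at [z] with bounded
    remainder coefficient, written in nested form. The factorization is required
    at every [x] because away from [z] it holds for the difference quotient
    anyway; all the content is in the value and the behaviour of [f1] near [z],
    and sums, products and inverses are handled by their usual difference
    quotients. *)
Fixpoint taylor (k : nat) (f : C -> C) (z : C) : Prop :=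
  match k with
  | O => exists M : R, locally z (fun x => Cmod (f x) <= M)
  | S k => exists f1 : C -> C,
      (forall x : C, f x = (f z + (x - z) * f1 x)%C) /\ taylor k f1 z
  end.

Lemma taylor_S (k : nat) (f : C -> C) (z : C) : taylor (S k) f z -> taylor k f z.
Proof.
  revert f; induction k as [|k IH]; intros f [f1 [Hf H1]].
  - destruct H1 as [M HM]. exists (Cmod (f z) + Rabs M).
    destruct (proj1 (locally_Cmod _ _) HM) as [d [Hd H]].
    apply locally_Cmod. exists (Rmin d 1). split; [apply Rmin_pos; lra|].
    intros x Hx. rewrite (Hf x). eapply Rle_trans; [apply Cmod_triangle|].
    apply Rplus_le_compat_l. rewrite Cmod_mult.
    specialize (H x (Rlt_le_trans _ _ _ Hx (Rmin_l _ _))).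
    assert (Cmod (x - z) <= 1) by (left; exact (Rlt_le_trans _ _ _ Hx (Rmin_r _ _))).
    rewrite <- (Rmult_1_l (Rabs M)).
    apply Rmult_le_compat; auto using Cmod_ge_0.
    eapply Rle_trans; [apply H|apply Rle_abs].
  - exists f1; split; [assumption|apply IH; assumption].
Qed.

Lemma taylor_le (k l : nat) (f : C -> C) (z : C) :
  (k <= l)%nat -> taylor l f z -> taylor k f z.
Proof. induction 1; auto using taylor_S. Qed.

(** The difference quotients of [f] and [g] agree near [z] once that of [g] is
    given the value of that of [f] at [z]. *)
Lemma taylor_ext (k : nat) (f g : C -> C) (z : C) :
  locally z (fun x => f x = g x) -> taylor k f z -> taylor k g z.
Proof.
  revert f g; induction k as [|k IH]; intros f g Hfg.
  - intros [M HM]. exists M. generalize (filter_and _ _ Hfg HM).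
    apply filter_imp. intros x [<- H]; exact H.
  - intros [f1 [Hf H1]].
    pose (g1 := fun x => if excluded_middle_informative (x = z) then f1 z
                         else ((g x - g z) / (x - z))%C).
    exists g1; split.
    + intros x. unfold g1. destruct (excluded_middle_informative (x = z)) as [->|n].
      * ring.
      * field. apply Cminus_neq_0, n.
    + apply (IH f1); [|assumption]. generalize Hfg; apply filter_imp.
      intros x Hx. unfold g1.
      destruct (excluded_middle_informative (@eq C x z)) as [->|n].
      * reflexivity.
      * rewrite <- Hx, <- (locally_singleton _ _ Hfg), (Hf x). field.
        apply Cminus_neq_0, n.
Qed.

Lemma taylor_const (k : nat) (c z : C) : taylor k (fun _ => c) z.
Proof.
  revert c; induction k as [|k IH]; intros c.
  - exists (Cmod c). apply filter_forall. intros; lra.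
  - exists (fun _ => RtoC 0); split; [intros; ring|apply IH].
Qed.

Lemma taylor_id (k : nat) (z : C) : taylor k (fun x => x) z.
Proof.
  apply taylor_S. exists (fun _ => RtoC 1); split; [intros; ring|apply taylor_const].
Qed.

Lemma taylor_plus (k : nat) (f g : C -> C) (z : C) :
  taylor k f z -> taylor k g z -> taylor k (fun x => (f x + g x)%C) z.
Proof.
  revert f g; induction k as [|k IH]; intros f g.
  - intros [M HM] [N HN]. exists (M + N). generalize (filter_and _ _ HM HN).
    apply filter_imp. intros x [H1 H2].
    eapply Rle_trans; [apply Cmod_triangle|lra].
  - intros [f1 [Hf H1]] [g1 [Hg H2]]. exists (fun x => (f1 x + g1 x)%C); split.
    + intros x. rewrite (Hf x), (Hg x). ring.
    + apply IH; assumption.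
Qed.

Lemma taylor_mult (k : nat) (f g : C -> C) (z : C) :
  taylor k f z -> taylor k g z -> taylor k (fun x => (f x * g x)%C) z.
Proof.
  revert f g; induction k as [|k IH]; intros f g Tf Tg.
  - destruct Tf as [M HM], Tg as [N HN].
    exists (M * N). generalize (filter_and _ _ HM HN).
    apply filter_imp. intros x [H1 H2]. rewrite Cmod_mult.
    apply Rmult_le_compat; auto using Cmod_ge_0.
  - pose proof (taylor_S _ _ _ Tg) as Tg'.
    destruct Tf as [f1 [Hf H1]], Tg as [g1 [Hg H2]].
    exists (fun x => (f1 x * g x + f z * g1 x)%C); split.
    + intros x. rewrite (Hf x). rewrite (Hg x) at 1 2. ring.
    + apply taylor_plus; apply IH; auto using taylor_const.
Qed.

Lemma taylor_scal (k : nat) (c : C) (f : C -> C) (z : C) :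
  taylor k f z -> taylor k (fun x => (c * f x)%C) z.
Proof. intros H. apply (taylor_mult k (fun _ => c)); auto using taylor_const. Qed.

Lemma taylor_minus (k : nat) (f g : C -> C) (z : C) :
  taylor k f z -> taylor k g z -> taylor k (fun x => (f x - g x)%C) z.
Proof.
  intros Tf Tg.
  apply taylor_ext with (fun x => (f x + - RtoC 1 * g x)%C).
  - apply filter_forall. intros x. ring.
  - apply taylor_plus, taylor_scal; assumption.
Qed.

Lemma taylor_pow (k n : nat) (f : C -> C) (z : C) :
  taylor k f z -> taylor k (fun x => (f x ^ n)%C) z.
Proof.
  intros Tf. induction n as [|n IH]; simpl.
  - apply taylor_const.
  - apply taylor_mult; assumption.
Qed.

Lemma taylor_continuous (k : nat) (f : C -> C) (z : C) (e : R) :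
  taylor (S k) f z -> 0 < e -> locally z (fun x => Cmod (f x - f z) < e).
Proof.
  intros Tf He. apply (taylor_le 1) in Tf; [|lia].
  destruct Tf as [f1 [Hf [M HM]]].
  destruct (proj1 (locally_Cmod _ _) HM) as [d [Hd H]].
  apply locally_Cmod. exists (Rmin d (e / (Rabs M + 1))).
  pose proof (Rabs_pos M) as HM0.
  split; [apply Rmin_pos; [|apply Rdiv_lt_0_compat]; lra|].
  intros x Hx. rewrite (Hf x).
  replace (f z + (x - z) * f1 x - f z)%C with ((x - z) * f1 x)%C by ring.
  rewrite Cmod_mult.
  pose proof (H x (Rlt_le_trans _ _ _ Hx (Rmin_l _ _))) as H1.
  pose proof (Rlt_le_trans _ _ _ Hx (Rmin_r _ _)) as H2.
  apply (Rmult_lt_compat_r (Rabs M + 1)) in H2; [|lra].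
  replace (e / (Rabs M + 1) * (Rabs M + 1)) with e in H2 by (field; lra).
  eapply Rle_lt_trans; [|apply H2].
  apply Rmult_le_compat_l; [apply Cmod_ge_0|]. pose proof (Rle_abs M); lra.
Qed.

(** [1 / f = 1 / f z - (x - z) f1 / (f z f)] reduces order [k + 1] to order [k].
    Order 0 needs [f] to stay away from 0 near [z], hence continuity, which is
    the extra order in the hypothesis. *)
Lemma taylor_inv (k : nat) (f : C -> C) (z : C) :
  f z <> RtoC 0 -> taylor (S k) f z -> taylor k (fun x => (/ f x)%C) z.
Proof.
  intros Hz. induction k as [|k IH]; intros Tf.
  - apply Cmod_gt_0 in Hz. exists (/ (Cmod (f z) / 2)).
    assert (0 < Cmod (f z) / 2) as He by lra.
    generalize (taylor_continuous _ _ _ _ Tf He). apply filter_imp.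
    intros x Hx.
    assert (Cmod (f z) / 2 < Cmod (f x)) as H1.
    { pose proof (Cmod_triangle (f z - f x) (f x)) as H.
      replace (f z - f x + f x)%C with (f z) in H by ring.
      rewrite Cmod_minus_sym in H. lra. }
    rewrite Cmod_inv.
    + apply Rinv_le_contravar; lra.
    + intros E. rewrite E, Cmod_0 in H1. lra.
  - assert (locally z (fun x => f x <> RtoC 0)) as Hnz.
    { apply Cmod_gt_0 in Hz.
      generalize (taylor_continuous _ _ _ _ Tf Hz). apply filter_imp.
      intros x Hx E. rewrite E in Hx. rewrite Cmod_minus_sym in Hx.
      replace (f z - RtoC 0)%C with (f z) in Hx by ring. lra. }
    pose proof (taylor_S _ _ _ Tf) as Tf'.
    apply IH in Tf'. destruct Tf as [f1 [Hf H1]].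
    apply taylor_ext with
      (fun x => (/ f z + (x - z) * (- / f z * (f1 x * / f x)))%C).
    + generalize Hnz. apply filter_imp. intros x Hx.
      rewrite (Hf x) in Hx |- *. field. split; assumption.
    + exists (fun x => (- / f z * (f1 x * / f x))%C). split.
      * intros x. ring.
      * apply taylor_scal, taylor_mult; [|assumption].
        apply taylor_S, H1.
Qed.

(** * The maximum principle *)

Lemma list_has_max (A : Type) (P : A -> R) (a : A) (l : list A) :
  exists m : A, In m (a :: l) /\ forall x : A, In x (a :: l) -> P x <= P m.
Proof.
  revert a; induction l as [|b l IH]; intros a.
  - exists a; split; [left; reflexivity|]. intros x [->|[]]; lra.
  - destruct (IH b) as [m [Hm Hmax]].
    destruct (Rle_dec (P a) (P m)) as [H|H].
    + exists m; split; [right; assumption|].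
      intros x [<-|Hx]; [assumption|apply Hmax, Hx].
    + exists a; split; [left; reflexivity|].
      intros x [<-|Hx]; [lra|]. specialize (Hmax x Hx). lra.
Qed.

(** If no point of [K] were a maximum, every point of a square containing [K]
    would have a neighbourhood on which [P] is less, on [K], than one of its
    values on [K]. Finitely many of these neighbourhoods cover the square, and
    the largest of the corresponding values contradicts the one covering it. *)
Lemma exists_max_on_compact (K : C -> Prop) (P : C -> R) (B : R) :
  (exists z : C, K z) ->
  (forall z : C, K z -> Cmod z <= B) ->
  (forall z : C, ~ K z -> locally z (fun x => ~ K x)) ->
  (forall (z : C) (e : R), K z -> 0 < e -> locally z (fun x => P x < P z + e)) ->
  exists z : C, K z /\ forall x : C, K x -> P x <= P z.
Proof.
  intros [z0 Hz0] Hbd Hcl Husc. apply NNPP. intros Hno.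
  assert (forall z, K z -> exists x, K x /\ P z < P x) as Hlarger.
  { intros z Hz. apply NNPP. intros H. apply Hno. exists z; split; [assumption|].
    intros x Hx. apply Rnot_lt_le. intros Hlt. apply H. exists x; split; assumption. }
  assert (forall t : C, exists s : posreal * C, K (snd s) /\
            forall x : C, ball t (fst s) x -> K x -> P x < P (snd s)) as Hloc.
  { intros t. destruct (classic (K t)) as [Ht|Ht].
    - destruct (Hlarger t Ht) as [t' [Ht' Hlt]].
      destruct (Husc t (P t' - P t) Ht ltac:(lra)) as [d Hd].
      exists (d, t'); split; [assumption|]. intros x Hx _.
      specialize (Hd x Hx). simpl in *. lra.
    - destruct (Hcl t Ht) as [d Hd].
      exists (d, z0); split; [assumption|]. intros x Hx Hk.
      destruct (Hd x Hx Hk). }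
  pose (s := fun t => proj1_sig (constructive_indefinite_description _ (Hloc t))).
  assert (forall t : C, K (snd (s t)) /\
            forall x : C, ball t (fst (s t)) x -> K x -> P x < P (snd (s t))) as Hs.
  { intros t. unfold s. apply proj2_sig. }
  clearbody s.
  pose (pt := fun u : Compactness.Tn 2 R => (fst u, fst (snd u)) : C).
  apply (compactness_list 2 (- B, (- B, tt)) (B, (B, tt)) (fun u => fst (s (pt u)))).
  intros [l Hl].
  assert (forall x : C, K x -> exists u, In u l /\ P x < P (snd (s (pt u)))) as Hcov.
  { intros x Hx. destruct x as [x y].
    assert (- B <= x <= B /\ - B <= y <= B) as [Hx1 Hy1].
    { pose proof (Rmax_Cmod (x, y)) as Hm. simpl in Hm.
      pose proof (Hbd _ Hx).
      pose proof (Rmax_l (Rabs x) (Rabs y)). pose proof (Rmax_r (Rabs x) (Rabs y)).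
      split; apply Rabs_le_between; lra. }
    destruct (Hl (x, (y, tt))) as [u [Hu [_ Hc]]].
    { simpl. tauto. }
    exists u; split; [assumption|]. apply (proj2 (Hs (pt u))); [|assumption].
    destruct u as [u1 [u2 []]]. simpl in Hc. split; simpl; apply Hc. }
  destruct l as [|u l].
  - destruct (Hcov z0 Hz0) as [u [[] _]].
  - destruct (list_has_max _ (fun u => P (snd (s (pt u)))) u l) as [m [_ Hmax]].
    destruct (Hcov _ (proj1 (Hs (pt m)))) as [v [Hv Hlt]].
    specialize (Hmax v Hv). simpl in Hmax. lra.
Qed.

(** The left-hand expression bounds from below the real part of [conj c * d]. *)
Lemma Re_conj_mult_le (c d : C) : - (Cmod c * Cmod d) <= Re c * Re d + Im c * Im d.
Proof.
  pose proof (re_le_Cmod (Cconj c * d)) as H.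
  rewrite Cmod_mult, Cmod_conj in H. apply Rabs_le_between in H.
  destruct c as [c1 c2], d as [d1 d2]. unfold Re, Im in *. simpl in *. lra.
Qed.

Lemma exists_small (a b c : R) :
  0 < a -> 0 < b -> 0 < c -> exists t : R, 0 < t /\ t < a /\ t < b /\ t < c.
Proof.
  intros Ha Hb Hc. exists (Rmin a (Rmin b c) / 2).
  pose proof (Rmin_l a (Rmin b c)). pose proof (Rmin_r a (Rmin b c)).
  pose proof (Rmin_l b c). pose proof (Rmin_r b c).
  assert (0 < Rmin a (Rmin b c)) by (repeat apply Rmin_pos; assumption).
  repeat split; lra.
Qed.

Lemma four_point_mean (Q : C -> C) (z : C) :
  taylor 3 Q z ->
  exists M d : R, 0 <= M /\ 0 < d /\ forall t : R, 0 < t < d ->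
    Cmod (Q (z + RtoC t) + Q (z + - RtoC t) + Q (z + Ci * RtoC t)
          + Q (z + - (Ci * RtoC t)) - RtoC 4 * Q z)%C <= 4 * M * t ^ 3.
Proof.
  intros [Q1 [HQ [Q2 [HQ1 [Q3 [HQ2 [M HM]]]]]]].
  destruct (proj1 (locally_Cmod _ _) HM) as [d [Hd H]].
  exists M, d. split; [|split; [assumption|]].
  { eapply Rle_trans; [apply Cmod_ge_0|exact (locally_singleton _ _ HM)]. }
  intros t Ht.
  assert (forall w : C, Cmod w = t -> Cmod (Q3 (z + w)%C) <= M) as Hw.
  { intros w Hw. apply H. replace (z + w - z)%C with w by ring. lra. }
  assert (forall w : C, Q (z + w)%C =
    (Q z + w * Q1 z + w * w * Q2 z + w * w * w * Q3 (z + w))%C) as HQw.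
  { intros w. rewrite (HQ (z + w)%C), (HQ1 (z + w)%C), (HQ2 (z + w)%C).
    replace (z + w - z)%C with w by ring. ring. }
  assert (Ci * Ci = - RtoC 1)%C as Hi.
  { unfold Ci, Cmult, Copp, RtoC. simpl. f_equal; ring. }
  assert (Cmod (RtoC t) = t) as Mt by (rewrite Cmod_R; apply Rabs_pos_eq; lra).
  assert (Cmod (- RtoC t) = t) as Mt' by (rewrite Cmod_opp; exact Mt).
  assert (Cmod (Ci * RtoC t) = t) as Mit by (rewrite Cmod_mult, Cmod_Ci, Mt; ring).
  assert (Cmod (- (Ci * RtoC t)) = t) as Mit' by (rewrite Cmod_opp; exact Mit).
  pose proof (Hw _ Mt) as R1. pose proof (Hw _ Mt') as R2.
  pose proof (Hw _ Mit) as R3. pose proof (Hw _ Mit') as R4.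
  (* 1 + i + i^2 + i^3 = 0 and 1 + i^2 + i^4 + i^6 = 0 remove the terms of
     degree one and two *)
  assert (Q (z + RtoC t) + Q (z + - RtoC t) + Q (z + Ci * RtoC t)
          + Q (z + - (Ci * RtoC t)) - RtoC 4 * Q z
      = RtoC t * RtoC t * RtoC t * (Q3 (z + RtoC t) - Q3 (z + - RtoC t)
        + - Ci * Q3 (z + Ci * RtoC t) + Ci * Q3 (z + - (Ci * RtoC t))))%C as ->.
  { rewrite !HQw.
    replace (Ci * RtoC t * (Ci * RtoC t))%C with (- RtoC 1 * RtoC t * RtoC t)%C
      by (rewrite <- Hi; ring).
    replace (- (Ci * RtoC t) * - (Ci * RtoC t))%C
      with (- RtoC 1 * RtoC t * RtoC t)%C by (rewrite <- Hi; ring).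
    ring. }
  rewrite !Cmod_mult, Mt.
  assert (Cmod (Q3 (z + RtoC t) - Q3 (z + - RtoC t)
      + - Ci * Q3 (z + Ci * RtoC t) + Ci * Q3 (z + - (Ci * RtoC t)))%C <= 4 * M) as H4.
  { eapply Rle_trans; [apply Cmod_triangle|]. rewrite Cmod_mult, Cmod_Ci.
    eapply Rle_trans; [apply Rplus_le_compat_r, Cmod_triangle|].
    rewrite Cmod_mult, Cmod_opp, Cmod_Ci.
    eapply Rle_trans; [apply Rplus_le_compat_r, Rplus_le_compat_r, Cmod_triangle|].
    rewrite Cmod_opp. lra. }
  replace (4 * M * t ^ 3) with (t * t * t * (4 * M)) by ring.
  apply Rmult_le_compat_l; [|assumption].
  apply Rmult_le_pos; [apply Rmult_le_pos|]; lra.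
Qed.

(** With [q = Q z], the inequality [2 Re (conj q * Q w) <= |q| ^ 2 + |Q w| ^ 2]
    at the four points of [four_point_mean] shows that the mean of [|Q| ^ 2]
    over them is at least [|q| ^ 2 - O(t ^ 3)], whereas the mean of
    [e |x| ^ 2] exceeds [e |z| ^ 2] by exactly [e t ^ 2]. *)
Lemma no_local_max (Q : C -> C) (z : C) (e : R) (U : C -> Prop) :
  taylor 3 Q z -> 0 < e -> locally z U ->
  exists x : C, U x /\
    Cmod (Q z) ^ 2 + e * Cmod z ^ 2 < Cmod (Q x) ^ 2 + e * Cmod x ^ 2.
Proof.
  intros TQ He HU.
  destruct (four_point_mean Q z TQ) as [M [d [HM0 [Hd Hmean]]]].
  destruct (proj1 (locally_Cmod _ _) HU) as [d' [Hd' H]].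
  pose proof (Cmod_ge_0 (Q z)) as Hq.
  assert (0 <= Cmod (Q z) * M) as HqM by (apply Rmult_le_pos; assumption).
  destruct (exists_small d d' (e / (2 * Cmod (Q z) * M + 1)))
    as [t [Ht [Htd [Htd' Hte]]]]; try assumption.
  { apply Rdiv_lt_0_compat; lra. }
  apply (Rmult_lt_compat_r (2 * Cmod (Q z) * M + 1)) in Hte; [|lra].
  replace (e / (2 * Cmod (Q z) * M + 1) * (2 * Cmod (Q z) * M + 1)) with e in Hte
    by (field; lra).
  apply NNPP. intros Hno.
  assert (forall w : C, Cmod w = t ->
    Cmod (Q (z + w)%C) ^ 2 + e * Cmod (z + w) ^ 2 <= Cmod (Q z) ^ 2 + e * Cmod z ^ 2)
    as Hw.
  { intros w Hw. apply Rnot_lt_le. intros Hlt. apply Hno.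
    exists (z + w)%C. split; [|assumption]. apply H.
    replace (z + w - z)%C with w by ring. lra. }
  assert (Cmod (RtoC t) = t) as Mt by (rewrite Cmod_R; apply Rabs_pos_eq; lra).
  assert (Cmod (Ci * RtoC t) = t) as Mit by (rewrite Cmod_mult, Cmod_Ci, Mt; ring).
  pose proof (Hw _ Mt) as P1. pose proof (Hw _ Mit) as P3.
  pose proof (Hw _ (eq_trans (Cmod_opp _) Mt)) as P2.
  pose proof (Hw _ (eq_trans (Cmod_opp _) Mit)) as P4.
  specialize (Hmean t (conj Ht Htd)).
  apply (Rmult_le_compat_l (Cmod (Q z))) in Hmean; [|assumption].
  pose proof (Re_conj_mult_le (Q z) (Q (z + RtoC t) + Q (z + - RtoC t)
    + Q (z + Ci * RtoC t) + Q (z + - (Ci * RtoC t)) - RtoC 4 * Q z)%C) as HRe.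
  apply Ropp_le_contravar in Hmean.
  pose proof (Rle_trans _ _ _ Hmean HRe) as HE.
  assert (0 < (e - 2 * Cmod (Q z) * M * t) * t ^ 2) as Hpos.
  { apply Rmult_lt_0_compat; [nra|]. apply pow_lt, Ht. }
  assert (0 < e * t ^ 2 - 2 * (Cmod (Q z) * (M * t ^ 3))) as Hpos' by nra.
  rewrite !Cmod2_alt in P1, P2, P3, P4.
  clear - P1 P2 P3 P4 HE Hpos'.
  revert P1 P2 P3 P4 HE Hpos'.
  generalize (Q (z + RtoC t)%C) (Q (z + - RtoC t)%C) (Q (z + Ci * RtoC t)%C)
    (Q (z + - (Ci * RtoC t))%C) (Cmod (Q z)) (Q z).
  intros [a1 a2] [b1 b2] [c1 c2] [d1 d2] mq [q1 q2].
  destruct z as [x y]. unfold Re, Im, Ci, RtoC, Cplus, Cminus, Cmult, Copp. simpl.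
  intros P1 P2 P3 P4 HE Hpos.
  pose proof (pow2_ge_0 (a1 - q1)). pose proof (pow2_ge_0 (a2 - q2)).
  pose proof (pow2_ge_0 (b1 - q1)). pose proof (pow2_ge_0 (b2 - q2)).
  pose proof (pow2_ge_0 (c1 - q1)). pose proof (pow2_ge_0 (c2 - q2)).
  pose proof (pow2_ge_0 (d1 - q1)). pose proof (pow2_ge_0 (d2 - q2)).
  nra.
Qed.

Lemma Cmod_sq_semicontinuous (f : C -> C) (z : C) (e : R) :
  taylor 1 f z -> 0 < e -> locally z (fun x => Cmod (f x) ^ 2 < Cmod (f z) ^ 2 + e).
Proof.
  intros Tf He. pose proof (Cmod_ge_0 (f z)) as Hf0.
  assert (0 < Rmin 1 (e / (2 * Cmod (f z) + 1))) as Hd.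
  { apply Rmin_pos; [|apply Rdiv_lt_0_compat]; lra. }
  generalize (taylor_continuous _ _ _ _ Tf Hd). apply filter_imp.
  intros x Hx.
  pose proof (Rlt_le_trans _ _ _ Hx (Rmin_l _ _)) as Hx1.
  pose proof (Rlt_le_trans _ _ _ Hx (Rmin_r _ _)) as Hx2.
  pose proof (Cmod_ge_0 (f x)) as Hf1.
  pose proof (Cmod_ge_0 (f x - f z)) as Hf2.
  apply (Rmult_lt_compat_r (2 * Cmod (f z) + 1)) in Hx2; [|lra].
  replace (e / (2 * Cmod (f z) + 1) * (2 * Cmod (f z) + 1)) with e in Hx2
    by (field; lra).
  pose proof (Cmod_triangle (f x - f z) (f z)) as Htr.
  replace (f x - f z + f z)%C with (f x) in Htr by ring.
  nra.
Qed.

(** A maximum of [|Q| ^ 2 + e |z| ^ 2] on [K] cannot lie where [K] is a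
    neighbourhood, so it lies where [|Q| <= M]; this bounds [|Q| ^ 2] on [K] by
    [M ^ 2 + e B ^ 2], and [e] is arbitrary. *)
Lemma maximum_principle (K : C -> Prop) (Q : C -> C) (M B : R) :
  (forall z : C, K z -> Cmod z <= B) ->
  (forall z : C, ~ K z -> locally z (fun x => ~ K x)) ->
  (forall z : C, K z -> taylor 3 Q z) ->
  (forall z : C, K z -> locally z K \/ Cmod (Q z) <= M) ->
  forall z : C, K z -> Cmod (Q z) <= M.
Proof.
  intros Hbd Hcl HQ Hbdry z Hz.
  assert (forall e : R, 0 < e -> exists m : C, K m /\ Cmod (Q m) <= M /\
    Cmod (Q z) ^ 2 + e * Cmod z ^ 2 <= Cmod (Q m) ^ 2 + e * Cmod m ^ 2) as Hmax.
  { intros e He.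
    destruct (exists_max_on_compact K (fun x => Cmod (Q x) ^ 2 + e * Cmod x ^ 2) B)
      as [m [Hm Hmax]]; try assumption.
    - exists z; assumption.
    - intros x c Hx Hc.
      pose proof (taylor_le 1 3 _ _ ltac:(lia) (HQ x Hx)) as TQ.
      assert (0 < c / 2) as Hc1 by lra.
      assert (0 < c / (2 * e)) as Hc2 by (apply Rdiv_lt_0_compat; lra).
      generalize (filter_and (F := locally x) _ _
        (Cmod_sq_semicontinuous Q x _ TQ Hc1)
        (Cmod_sq_semicontinuous _ x _ (taylor_id 1 x) Hc2)).
      apply filter_imp. intros y [H1 H2].
      apply (Rmult_lt_compat_l e) in H2; [|assumption].
      replace (e * (Cmod x ^ 2 + c / (2 * e))) with (e * Cmod x ^ 2 + c / 2) in H2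
        by (field; lra).
      lra.
    - exists m. split; [assumption|]. split; [|apply Hmax, Hz].
      destruct (Hbdry m Hm) as [Hn|H]; [|assumption].
      destruct (no_local_max Q m e K (HQ m Hm) He Hn) as [x [Hx Hlt]].
      specialize (Hmax x Hx). simpl in Hmax, Hlt. lra. }
  assert (0 <= M) as HM0.
  { destruct (Hmax 1 ltac:(lra)) as [m [_ [H _]]].
    eapply Rle_trans; [apply Cmod_ge_0|exact H]. }
  pose proof (Cmod_ge_0 (Q z)) as Hq.
  apply Rnot_lt_le. intros Hlt.
  pose (e := (Cmod (Q z) ^ 2 - M ^ 2) / (2 * (B ^ 2 + 1))).
  assert (0 < Cmod (Q z) ^ 2 - M ^ 2) as Hgap by nra.
  assert (0 < B ^ 2 + 1) as HB by nra.
  assert (0 < e) as He by (apply Rdiv_lt_0_compat; lra).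
  assert (e * (B ^ 2 + 1) = (Cmod (Q z) ^ 2 - M ^ 2) / 2) as HeB
    by (unfold e; field; lra).
  destruct (Hmax e He) as [m [Hm [HQm Hle]]].
  pose proof (Hbd m Hm) as Hmb. pose proof (Cmod_ge_0 m). pose proof (Cmod_ge_0 (Q m)).
  assert (Cmod (Q m) ^ 2 <= M ^ 2) by (apply pow_incr; lra).
  assert (e * Cmod m ^ 2 <= e * B ^ 2)
    by (apply Rmult_le_compat_l; [lra|]; apply pow_incr; lra).
  pose proof (Rmult_le_pos e (Cmod z ^ 2) ltac:(lra) (pow2_ge_0 _)).
  lra.
Qed.

(** * Power series *)

Lemma expansion_value (f : C -> C) (z : C) (a : nat -> C) :
  has_expansion f z a -> f z = a O.
Proof.
  intros [r [Hr H]].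
  specialize (H z). replace (z - z)%C with (RtoC 0) in H by ring.
  rewrite Cmod_0 in H. specialize (H Hr).
  pose proof (is_pseries_0 (V := C_NormedModule) a) as H0.
  change (RtoC 0) with (zero : C_AbsRing) in H.
  exact (filterlim_locally_unique (V := C_NormedModule) _ _ _ H H0).
Qed.

(** Dividing by the first power removes the constant coefficient and shifts the
    others; by iteration this gives all orders of [taylor] and the division by
    [(x - z) ^ n] at a zero. *)
Lemma expansion_quotient (f : C -> C) (z : C) (a : nat -> C) :
  has_expansion f z a ->
  exists f1 : C -> C, (forall x : C, f x = (f z + (x - z) * f1 x)%C) /\
    has_expansion f1 z (fun n => a (S n)).
Proof.
  intros Hf. pose proof (expansion_value _ _ _ Hf) as H0. destruct Hf as [r [Hr H]].
  exists (fun x => if excluded_middle_informative (x = z) then a 1%nat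
                   else ((f x - f z) / (x - z))%C).
  split.
  - intros x. destruct (excluded_middle_informative (x = z)) as [->|n].
    + ring.
    + field. apply Cminus_neq_0, n.
  - exists r; split; [assumption|]. intros x Hx.
    destruct (excluded_middle_informative (x = z)) as [->|n].
    + replace (z - z)%C with (RtoC 0) by ring.
      exact (is_pseries_0 (V := C_NormedModule) (fun n => a (S n))).
    + apply Cminus_neq_0 in n.
      pose proof (is_pseries_decr_1 (V := C_NormedModule) a (x - z)%C (/ (x - z))%C
                    (f x) (Cinv_l _ n) (H x Hx)) as H1.
      rewrite H0.
      replace ((f x - a O) / (x - z))%C with (/ (x - z) * (f x + - a O))%C
        by (field; assumption).
      exact H1.
Qed.

Lemma pow_n_Cpow (x : C) (n : nat) : pow_n (x : C_Ring) n = (x ^ n)%C.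
Proof. induction n as [|n IH]; [reflexivity|]. simpl. rewrite IH. reflexivity. Qed.
(** Convergence at distance [r / 2] bounds [|a_n| (r / 2) ^ n], so at distance at
    most [r / 4] the series is dominated by a geometric series of ratio
    [1 / 2]. *)
Lemma expansion_locally_bounded (f : C -> C) (z : C) (a : nat -> C) :
  has_expansion f z a -> taylor 0 f z.
Proof.
  intros [r [Hr H]].
  assert (exists M, forall n, Cmod (a n) * (r / 2) ^ n <= M) as [M HM].
  { assert (Cmod (RtoC (r / 2)) = r / 2) as Hr2
      by (rewrite Cmod_R; apply Rabs_pos_eq; lra).
    assert (Cmod (z + RtoC (r / 2) - z) < r) as Hlt.
    { replace (z + RtoC (r / 2) - z)%C with (RtoC (r / 2)) by ring. lra. }
    specialize (H _ Hlt).
    replace (z + RtoC (r / 2) - z)%C with (RtoC (r / 2)) in H by ring.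
    destruct (filterlim_bounded (V := C_NormedModule) _ (ex_intro _ _ H)) as [B HB].
    exists (2 * B). intros n.
    assert (forall n, Cmod (a n) * (r / 2) ^ n
              = Cmod (scal (pow_n (RtoC (r / 2) : C_Ring) n) (a n : C_NormedModule)))
      as Hn.
    { intros m. rewrite pow_n_Cpow.
      change (Cmod (a m) * (r / 2) ^ m = Cmod (RtoC (r / 2) ^ m * a m)).
      rewrite Cmod_mult, Cmod_pow, Hr2. ring. }
    rewrite Hn. destruct n as [|n].
    - specialize (HB O). rewrite sum_O in HB.
      eapply Rle_trans; [exact HB|].
      pose proof (Rle_trans _ _ _ (norm_ge_0 _) HB). lra.
    - pose proof (HB n) as H1. pose proof (HB (S n)) as H2.
      rewrite sum_Sn in H2.
      set (s := sum_n _ n) in *. set (t := scal _ _) in *.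
      change (Cmod s <= B) in H1. change (Cmod (s + t)%C <= B) in H2.
      change (Cmod t <= 2 * B).
      replace (t : C) with ((s + t) - s)%C by (unfold t, s; ring).
      eapply Rle_trans; [apply Cmod_triangle|]. rewrite Cmod_opp. lra. }
  assert (0 <= M) as HM0.
  { eapply Rle_trans; [|apply (HM O)]. simpl.
    pose proof (Cmod_ge_0 (a O)). lra. }
  exists (2 * M). apply locally_Cmod. exists (r / 4). split; [lra|].
  intros x Hx. specialize (H x ltac:(lra)).
  assert (is_lim_seq (fun n => norm (sum_n (fun k =>
      scal (pow_n ((x - z)%C : C_Ring) k) (a k : C_NormedModule)) n)) (Cmod (f x))) as Hlim.
  { eapply filterlim_comp; [exact H|]. apply (filterlim_norm (V := C_NormedModule)). }
  refine (is_lim_seq_le _ _ (Cmod (f x)) (2 * M) _ Hlim (is_lim_seq_const _)).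
  intros n. unfold sum_n.
  eapply Rle_trans; [apply (norm_sum_n_m (V := C_NormedModule))|].
  eapply Rle_trans; [apply (sum_n_m_le _ (fun k => M * (1 / 2) ^ k))|].
  - intros k. rewrite pow_n_Cpow. change (Cmod ((x - z) ^ k * a k) <= M * (1 / 2) ^ k).
    rewrite Cmod_mult, Cmod_pow.
    eapply Rle_trans; [apply Rmult_le_compat_r; [apply Cmod_ge_0|]|].
    + apply pow_incr. split; [apply Cmod_ge_0|]. left; exact Hx.
    + replace (r / 4) with (r / 2 * (1 / 2)) by field. rewrite Rpow_mult_distr.
      replace ((r / 2) ^ k * (1 / 2) ^ k * Cmod (a k))
        with (Cmod (a k) * (r / 2) ^ k * (1 / 2) ^ k) by ring.
      apply Rmult_le_compat_r; [apply pow_le; lra|apply HM].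
  - fold (sum_n (fun k => M * (1 / 2) ^ k) n).
    assert (forall m, sum_n (fun k => M * (1 / 2) ^ k) m = 2 * M - M * (1 / 2) ^ m) as Hg.
    { induction m as [|m IH]; [rewrite sum_O; simpl; ring|].
      rewrite sum_Sn, IH. unfold plus; simpl. field. }
    rewrite Hg. pose proof (Rmult_le_pos M ((1/2) ^ n) HM0 (pow_le (1/2) n ltac:(lra))).
    lra.
Qed.

Lemma expansion_taylor (k : nat) (f : C -> C) (z : C) (a : nat -> C) :
  has_expansion f z a -> taylor k f z.
Proof.
  revert f a; induction k as [|k IH]; intros f a Hf.
  - exact (expansion_locally_bounded _ _ _ Hf).
  - destruct (expansion_quotient _ _ _ Hf) as [f1 [H1 H2]].
    exists f1; split; [assumption|exact (IH _ _ H2)].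
Qed.

Lemma expansion_factor (f : C -> C) (z : C) (a : nat -> C) (n : nat) :
  has_expansion f z a -> (forall k : nat, (k < n)%nat -> a k = RtoC 0) ->
  exists (s : C -> C) (c : nat -> C), has_expansion s z c /\
    forall x : C, f x = ((x - z) ^ n * s x)%C.
Proof.
  revert f a; induction n as [|n IH]; intros f a Hf Ha.
  - exists f, a. split; [assumption|]. intros x. simpl. ring.
  - destruct (expansion_quotient _ _ _ Hf) as [f1 [H1 H2]].
    destruct (IH f1 _ H2) as [s [c [Hs Hc]]].
    { intros k Hk. apply Ha. lia. }
    exists s, c. split; [assumption|]. intros x.
    rewrite H1, (expansion_value _ _ _ Hf), Ha, Hc by lia. simpl. ring.
Qed.

(** * Derivatives and orders of zeros *)

Lemma C_derive_quotient (f f1 : C -> C) (z : C) :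
  (forall x : C, f x = (f z + (x - z) * f1 x)%C) -> taylor 1 f1 z ->
  C_derive f z = f1 z.
Proof.
  intros Hf T1. apply is_C_lim_unique.
  apply (filterlim_ext_loc f1).
  - exists (mkposreal 1 Rlt_0_1). intros x _ Hx. rewrite (Hf x). field.
    apply Cminus_neq_0, Hx.
  - intros P HP. destruct (proj1 (locally_Cmod _ _) HP) as [d [Hd H]].
    change (locally z (fun x => x <> z -> P (f1 x))).
    generalize (taylor_continuous _ _ _ _ T1 Hd). apply filter_imp.
    intros x Hx _. apply H, Hx.
Qed.

Lemma taylor_derive (k : nat) (f : C -> C) (z : C) :
  taylor (S (S k)) f z ->
  exists f1 : C -> C, (forall x : C, f x = (f z + (x - z) * f1 x)%C) /\
    taylor (S k) f1 z /\ C_derive f z = f1 z.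
Proof.
  intros [f1 [Hf H1]]. exists f1. split; [assumption|]. split; [assumption|].
  apply C_derive_quotient; [assumption|]. apply (taylor_le 1 (S k)); [lia|assumption].
Qed.

Lemma C_derive_mult (f p s : C -> C) (z : C) :
  (forall x : C, f x = (p x * s x)%C) -> taylor 2 p z -> taylor 2 s z ->
  C_derive f z = (C_derive p z * s z + p z * C_derive s z)%C.
Proof.
  intros Hf Tp Ts.
  destruct (taylor_derive _ _ _ Tp) as [p1 [Hp [Tp1 ->]]].
  destruct (taylor_derive _ _ _ Ts) as [s1 [Hs [Ts1 ->]]].
  rewrite (C_derive_quotient f (fun x => (p1 x * s x + p z * s1 x)%C)); [reflexivity| |].
  - intros x. rewrite !Hf, (Hp x). rewrite (Hs x) at 1 2. ring.
  - apply taylor_plus; [|apply taylor_scal, Ts1].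
    apply taylor_mult; [assumption|apply taylor_S, Ts].
Qed.

Lemma taylor_shift_pow (k n : nat) (b z : C) : taylor k (fun x => ((x - b) ^ n)%C) z.
Proof. apply taylor_pow, taylor_minus; auto using taylor_id, taylor_const. Qed.

Lemma C_derive_shift_pow (b : C) (n : nat) (z : C) :
  C_derive (fun x => ((x - b) ^ n)%C) z = (RtoC (INR n) * (z - b) ^ pred n)%C.
Proof.
  induction n as [|n IH].
  - rewrite (C_derive_quotient _ (fun _ => RtoC 0)).
    + simpl. ring.
    + intros x. simpl. ring.
    + apply taylor_const.
  - rewrite (C_derive_mult _ (fun x => (x - b)%C) (fun x => ((x - b) ^ n)%C)).
    + rewrite IH. rewrite (C_derive_quotient (fun x => (x - b)%C) (fun _ => RtoC 1)).
      * rewrite S_INR, RtoC_plus. destruct n as [|n]; simpl; ring.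
      * intros x. ring.
      * apply taylor_const.
    + intros x. reflexivity.
    + apply taylor_minus; auto using taylor_id, taylor_const.
    + apply taylor_shift_pow.
Qed.

Lemma C_derive_factor (f s : C -> C) (b : C) (n : nat) (z : C) :
  (forall x : C, f x = ((x - b) ^ n * s x)%C) -> taylor 2 s z ->
  C_derive f z =
    (RtoC (INR n) * (z - b) ^ pred n * s z + (z - b) ^ n * C_derive s z)%C.
Proof.
  intros Hf Ts. rewrite (C_derive_mult f _ s z Hf); [|apply taylor_shift_pow|assumption].
  rewrite C_derive_shift_pow. reflexivity.
Qed.

Lemma locally_lipschitz_neg (p : C -> R) (L : R) (z : C) :
  (forall x y : C, p y <= p x + L * Cmod (y - x)) -> p z < 0 ->
  locally z (fun x => p x < 0).
Proof.
  intros Hp Hz. apply locally_Cmod. pose proof (Rabs_pos L) as HL.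
  exists (- p z / (Rabs L + 1)). split; [apply Rdiv_lt_0_compat; lra|].
  intros x Hx. apply (Rmult_lt_compat_r (Rabs L + 1)) in Hx; [|lra].
  replace (- p z / (Rabs L + 1) * (Rabs L + 1)) with (- p z) in Hx by (field; lra).
  specialize (Hp z x). pose proof (Rle_abs L). pose proof (Cmod_ge_0 (x - z)). nra.
Qed.

(** This transfers regularity to [s = f / p] at points other than the centre,
    where [s] is only characterized by the product. *)
Lemma taylor_factor (k : nat) (f p s : C -> C) (z : C) :
  (forall x : C, f x = (p x * s x)%C) -> p z <> RtoC 0 ->
  taylor k f z -> taylor (S k) p z -> taylor k s z.
Proof.
  intros Hf Hz Tf Tp.
  apply taylor_ext with (fun x => (f x * / p x)%C).
  - assert (0 < Cmod (p z)) as Hz' by (apply Cmod_gt_0; assumption).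
    generalize (taylor_continuous _ _ _ _ Tp Hz'). apply filter_imp.
    intros x Hx. rewrite Hf. field. intros E. rewrite E in Hx.
    rewrite Cmod_minus_sym in Hx.
    replace (p z - RtoC 0)%C with (p z) in Hx by ring. lra.
  - apply taylor_mult; [assumption|]. apply taylor_inv; assumption.
Qed.

Lemma Cmod_dist_lipschitz (c x y : C) : Cmod (y - c) <= Cmod (x - c) + Cmod (y - x).
Proof.
  replace (y - c)%C with ((x - c) + (y - x))%C by ring. apply Cmod_triangle.
Qed.

(** The difference quotient of [f] at [c] has the value [f' c] at [c] and is at
    most [2 M / r] on the circle of radius [r], so the maximum principle bounds
    it at the centre. *)
Lemma cauchy_estimate (f : C -> C) (c : C) (r M : R) :
  0 < r ->
  (forall x : C, Cmod (x - c) <= r -> taylor 4 f x /\ Cmod (f x) <= M) ->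
  Cmod (C_derive f c) <= 2 * M / r.
Proof.
  intros Hr Hf.
  assert (Cmod (c - c) <= r) as Hc.
  { replace (c - c)%C with (RtoC 0) by ring. rewrite Cmod_0. lra. }
  destruct (taylor_derive _ _ _ (proj1 (Hf c Hc))) as [f1 [Hf1 [T1 ->]]].
  apply (maximum_principle (fun x => Cmod (x - c) <= r) f1 (2 * M / r) (Cmod c + r)).
  - intros x Hx. replace x with (c + (x - c))%C by ring.
    eapply Rle_trans; [apply Cmod_triangle|lra].
  - intros x Hx. apply Rnot_le_lt in Hx.
    assert (r - Cmod (x - c) < 0) as Hx' by lra.
    generalize (locally_lipschitz_neg (fun y => r - Cmod (y - c)) 1 x).
    intros H. eapply filter_imp; [|apply H; [|exact Hx']].
    + intros y Hy. simpl in Hy. lra.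
    + intros u v. pose proof (Cmod_dist_lipschitz c v u).
      rewrite (Cmod_minus_sym u v) in *. lra.
  - intros x Hx. destruct (excluded_middle_informative (x = c)) as [->|Hne]; [assumption|].
    apply (taylor_factor 3 (fun x => (f x - f c)%C) (fun x => (x - c)%C)).
    + intros y. rewrite (Hf1 y). ring.
    + apply Cminus_neq_0, Hne.
    + apply taylor_minus; [apply taylor_S, (Hf x Hx)|apply taylor_const].
    + apply taylor_minus; auto using taylor_id, taylor_const.
  - intros x Hx. destruct (Rle_lt_or_eq_dec _ _ Hx) as [Hlt|Heq].
    + left. assert (Cmod (x - c) - r < 0) as Hx' by lra.
      generalize (locally_lipschitz_neg (fun y => Cmod (y - c) - r) 1 x).
      intros H. eapply filter_imp; [|apply H; [|exact Hx']].
      * intros y Hy. simpl in Hy. lra.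
      * intros u v. pose proof (Cmod_dist_lipschitz c u v). lra.
    + right. apply (Rmult_le_reg_r r); [assumption|].
      replace (2 * M / r * r) with (2 * M) by (field; lra).
      rewrite <- Heq at 1. rewrite Rmult_comm, <- Cmod_mult.
      replace ((x - c) * f1 x)%C with (f x - f c)%C by (rewrite (Hf1 x); ring).
      eapply Rle_trans; [apply Cmod_triangle|]. rewrite Cmod_opp.
      pose proof (proj2 (Hf x Hx)). pose proof (proj2 (Hf c Hc)). lra.
  - exact Hc.
Qed.

Lemma C_derive_locally_bounded (f : C -> C) (z : C) :
  locally z (taylor 4 f) -> taylor 0 (C_derive f) z.
Proof.
  intros Hf.
  pose proof (taylor_le 0 4 _ _ ltac:(lia) (locally_singleton _ _ Hf)) as [M HM].
  destruct (proj1 (locally_Cmod _ _) (filter_and (F := locally z) _ _ Hf HM))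
    as [d [Hd H]].
  exists (2 * M / (d / 4)). apply locally_Cmod. exists (d / 2). split; [lra|].
  intros x Hx. apply cauchy_estimate; [lra|].
  intros y Hy. apply H. pose proof (Cmod_dist_lipschitz z x y). lra.
Qed.

Lemma locally_taylor_factor (k n : nat) (f s : C -> C) (b : C) (c : nat -> C) :
  (forall x : C, f x = ((x - b) ^ n * s x)%C) -> has_expansion s b c ->
  locally b (taylor k f) -> locally b (taylor k s).
Proof.
  intros Hf Hs. apply filter_imp. intros x Tf.
  destruct (excluded_middle_informative (@eq C x b)) as [->|Hne].
  - exact (expansion_taylor _ _ _ _ Hs).
  - apply (taylor_factor k f (fun y => ((y - b) ^ n)%C)); try assumption.
    + apply Cpow_nz, Cminus_neq_0, Hne.
    + apply taylor_shift_pow.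
Qed.

Lemma le_0_of_le_small (A B d : R) :
  0 < d -> (forall t : R, 0 < t < d -> A <= t * B) -> A <= 0.
Proof.
  intros Hd H. apply Rnot_lt_le. intros HA. pose proof (Rabs_pos B) as HB.
  destruct (exists_small d d (A / (Rabs B + 1))) as [t [Ht [Htd [_ HtA]]]]; try assumption.
  { apply Rdiv_lt_0_compat; lra. }
  specialize (H t (conj Ht Htd)). pose proof (Rle_abs B).
  apply (Rmult_lt_compat_r (Rabs B + 1)) in HtA; [|lra].
  replace (A / (Rabs B + 1) * (Rabs B + 1)) with A in HtA by (field; lra).
  nra.
Qed.

(** Suppose that [g = (x - b) ^ m * s] with [0 < m < n]. Differentiating,
    [m (x - b) ^ (m - 1) s = g' - (x - b) ^ m s'], where [s'] is bounded near
    [b], and [|g'| <= |h'| = O(|x - b| ^ (n - 1))] is [O(|x - b| ^ m)]. Dividing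
    by [(x - b) ^ (m - 1)] and letting [x] tend to [b] gives [s b = 0], so one
    more factor can be extracted. *)
Lemma zero_order_transfer (h g : C -> C) (b : C) (c d : nat -> C) (n : nat) :
  has_expansion h b c -> (forall k : nat, (k < n)%nat -> c k = RtoC 0) ->
  has_expansion g b d -> g b = RtoC 0 ->
  locally b (taylor 4 h) -> locally b (taylor 4 g) ->
  locally b (fun x => Cmod (C_derive g x) <= Cmod (C_derive h x)) ->
  forall m : nat, (m <= n)%nat ->
  exists (s : C -> C) (e : nat -> C), has_expansion s b e /\
    forall x : C, g x = ((x - b) ^ m * s x)%C.
Proof.
  intros Hh Hc Hg Hgb Th Tg Hgh m.
  destruct (expansion_factor h b c n Hh Hc) as [T [cT [HT HhT]]].
  induction m as [|m IH]; intros Hm.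
  - exists g, d. split; [assumption|]. intros x. simpl. ring.
  - destruct IH as [s [e [Hs Hgs]]]; [lia|].
    enough (s b = RtoC 0) as Hsb.
    { destruct (expansion_quotient _ _ _ Hs) as [s1 [Hs1 He1]].
      exists s1, (fun n => e (S n)). split; [assumption|].
      intros x. rewrite Hgs, Hs1, Hsb. simpl. ring. }
    destruct m as [|m].
    { rewrite <- Hgb, Hgs. simpl. ring. }
    pose proof (locally_taylor_factor 4 _ _ _ _ _ Hgs Hs Tg) as Ts.
    pose proof (locally_taylor_factor 4 _ _ _ _ _ HhT HT Th) as TT.
    destruct (C_derive_locally_bounded _ _ Ts) as [M1 HM1].
    destruct (C_derive_locally_bounded _ _ TT) as [M2 HM2].
    destruct (expansion_taylor 0 _ _ _ HT) as [M3 HM3].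
    destruct (expansion_taylor 1 _ _ _ Hs) as [s1 [Hs1 [M4 HM4]]].
    destruct (proj1 (locally_Cmod _ _)
      (filter_and (F := locally b) _ _ (filter_and _ _ (filter_and _ _ Ts TT)
         (filter_and _ _ HM1 HM2))
         (filter_and _ _ (filter_and _ _ HM3 HM4) Hgh))) as [r [Hr H]].
    apply Cmod_eq_0, Rle_antisym; [|apply Cmod_ge_0].
    enough (INR (S m) * Cmod (s b) <= 0) as H0.
    { pose proof (lt_0_INR (S m) ltac:(lia)). pose proof (Cmod_ge_0 (s b)). nra. }
    apply (le_0_of_le_small _ (M1 + (INR n * M3 + M2) + INR (S m) * M4) (Rmin r 1));
      [apply Rmin_pos; lra|].
    intros t [Ht0 Ht1].
    pose proof (Rlt_le_trans _ _ _ Ht1 (Rmin_l _ _)) as Htr.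
    pose proof (Rlt_le_trans _ _ _ Ht1 (Rmin_r _ _)) as Ht.
    pose (x := (b + RtoC t)%C).
    assert (x - b = RtoC t)%C as Hxb by (unfold x; ring).
    assert (Cmod (RtoC t) = t) as Mt by (rewrite Cmod_R; apply Rabs_pos_eq; lra).
    destruct (H x) as [[[Tsx TTx] [H1 H2]] [[H3 H4] H5]];
      [rewrite Hxb, Mt; assumption|].
    rewrite (C_derive_factor _ _ _ _ _ Hgs (taylor_le 2 4 _ _ ltac:(lia) Tsx)) in H5.
    rewrite (C_derive_factor _ _ _ _ _ HhT (taylor_le 2 4 _ _ ltac:(lia) TTx)) in H5.
    rewrite Hxb in H5. simpl pred in H5.
    assert (Cmod (RtoC (INR n) * RtoC t ^ pred n * T x + RtoC t ^ n * C_derive T x)%C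
            <= t ^ S m * (INR n * M3 + M2)) as Hbh.
    { eapply Rle_trans; [apply Cmod_triangle|].
      rewrite !Cmod_mult, !Cmod_pow, Mt, Cmod_R, (Rabs_pos_eq _ (pos_INR n)).
      assert (forall j, (S m <= j)%nat -> 0 <= t ^ j <= t ^ S m) as Hp.
      { intros j Hj. split; [apply pow_le; lra|].
        replace j with (S m + (j - S m))%nat by lia. rewrite pow_add.
        rewrite <- (Rmult_1_r (t ^ S m)) at 2.
        apply Rmult_le_compat_l; [apply pow_le; lra|].
        rewrite <- (pow1 (j - S m)). apply pow_incr; lra. }
      replace (t ^ S m * (INR n * M3 + M2))
        with (INR n * t ^ S m * M3 + t ^ S m * M2) by ring.
      pose proof (pos_INR n).
      apply Rplus_le_compat; apply Rmult_le_compat; auto using Cmod_ge_0.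
      - apply Rmult_le_pos; [assumption|apply (Hp (pred n)); lia].
      - apply Rmult_le_compat_l; [assumption|apply (Hp (pred n)); lia].
      - apply (Hp n); lia.
      - apply (Hp n); lia. }
    assert (t ^ m * (INR (S m) * Cmod (s x)) <= t ^ m * (t * (M1 + (INR n * M3 + M2))))
      as Hmain.
    { replace (t ^ m * (INR (S m) * Cmod (s x)))
        with (Cmod (RtoC (INR (S m)) * RtoC t ^ m * s x)%C)
        by (rewrite !Cmod_mult, Cmod_pow, Mt, Cmod_R, (Rabs_pos_eq _ (pos_INR _)); ring).
      replace (RtoC (INR (S m)) * RtoC t ^ m * s x)%C
        with ((RtoC (INR (S m)) * RtoC t ^ m * s x + RtoC t ^ S m * C_derive s x)
              - RtoC t ^ S m * C_derive s x)%C by ring.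
      eapply Rle_trans; [apply Cmod_triangle|].
      rewrite Cmod_opp.
      replace (t ^ m * (t * (M1 + (INR n * M3 + M2))))
        with (t ^ S m * (INR n * M3 + M2) + t ^ S m * M1) by (simpl; ring).
      apply Rplus_le_compat; [eapply Rle_trans; [exact H5|exact Hbh]|].
      rewrite Cmod_mult, Cmod_pow, Mt.
      apply Rmult_le_compat_l; [apply pow_le; lra|assumption]. }
    apply Rmult_le_reg_l in Hmain; [|apply pow_lt; lra].
    assert (Cmod (s b) <= Cmod (s x) + t * M4) as Hsx.
    { replace (s b) with (s x - (x - b) * s1 x)%C by (rewrite (Hs1 x); ring).
      eapply Rle_trans; [apply Cmod_triangle|].
      rewrite Cmod_opp, Cmod_mult, Hxb, Mt.
      apply Rplus_le_compat_l, Rmult_le_compat_l; [lra|assumption]. }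
    apply (Rmult_le_compat_l (INR (S m))) in Hsx; [|apply pos_INR].
    lra.
Qed.

(** * Schwarz's lemma in the half-plane *)

Lemma Cmod_sq_reflect (z b : C) :
  Cmod (z - Cconj b) ^ 2 = Cmod (z - b) ^ 2 + 4 * Im z * Im b.
Proof.
  rewrite !Cmod2_alt. destruct z, b. unfold Re, Im. simpl. ring.
Qed.

Lemma Cmod_reflect_lt (z b : C) :
  0 < Im z -> 0 < Im b -> Cmod (z - b) < Cmod (z - Cconj b).
Proof.
  intros Hz Hb. pose proof (Cmod_sq_reflect z b) as H.
  pose proof (Rmult_lt_0_compat _ _ Hz Hb).
  pose proof (Cmod_ge_0 (z - Cconj b)). pose proof (Cmod_ge_0 (z - b)). nra.
Qed.

(** The sublevel sets of [|z - b| / |z - conj b|] below 1 are discs inside the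
    half-plane; they play the role of the concentric discs [|w| <= r] in
    Schwarz's lemma. *)
Lemma Apollonius_disc_upper (r : R) (z b : C) :
  0 < r < 1 -> 0 < Im b -> Cmod (z - b) <= r * Cmod (z - Cconj b) -> 0 < Im z.
Proof.
  intros Hr Hb H. apply Rnot_le_lt. intros Hz.
  pose proof (Cmod_sq_reflect z b) as Hs.
  pose proof (Cmod_ge_0 (z - b)) as H1. pose proof (Cmod_ge_0 (z - Cconj b)) as H2.
  assert (0 <= - Im z * Im b) as H3 by (apply Rmult_le_pos; lra).
  assert (Cmod (z - Cconj b) <= Cmod (z - b)) as H4 by nra.
  apply (Rmult_le_compat_l r) in H4; [|lra].
  assert (Cmod (z - b) = 0) as H5 by nra.
  apply Cmod_eq_0 in H5.
  assert (z = b) as -> by (replace z with (z - b + b)%C by ring; rewrite H5; ring).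
  lra.
Qed.

Lemma pow_1_minus_ge (n : nat) (t : R) : 0 <= t <= 1 -> 1 - INR n * t <= (1 - t) ^ n.
Proof.
  intros Ht. induction n as [|n IH].
  - simpl. lra.
  - rewrite S_INR. simpl. pose proof (pos_INR n).
    apply (Rmult_le_compat_l (1 - t)) in IH; [|lra].
    pose proof (Rmult_le_pos (INR n) (t * t) ltac:(assumption) ltac:(nra)). nra.
Qed.

(** The Cayley transform [w = (z - b) / (z - conj b)] maps the half-plane to the
    unit disc, and [F / (2 - F)] has modulus at most 1. The quotient of the
    latter by [w ^ n] is [Q], in which the zero of [F] has been divided out. On
    [|w| = r] it is at most [1 / r ^ n], hence also inside, and [r] tends to
    1. *)
Lemma half_plane_schwarz (F s : C -> C) (b : C) (n : nat) :
  0 < Im b ->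
  taylor 3 s b -> (forall x : C, F x = ((x - b) ^ n * s x)%C) ->
  (forall x : C, 0 < Im x -> taylor 4 F x /\ Re (F x) < 1) ->
  forall z : C, 0 < Im z ->
    Cmod (F z) * Cmod (z - Cconj b) ^ n
    <= Cmod (z - b) ^ n * Cmod (RtoC 2 - F z).
Proof.
  intros Hb Hs HFs HF z Hz.
  assert (forall x, 0 < Im x ->
            RtoC 2 - F x <> RtoC 0 /\ Cmod (F x) <= Cmod (RtoC 2 - F x))%C as H2F.
  { intros x Hx. destruct (HF x Hx) as [_ H1]. split.
    - intros E. apply (f_equal Re) in E. destruct (F x). unfold Re in *. simpl in *. lra.
    - pose proof (Cmod2_alt (F x)) as E1. pose proof (Cmod2_alt (RtoC 2 - F x)) as E2.
      pose proof (Cmod_ge_0 (F x)). pose proof (Cmod_ge_0 (RtoC 2 - F x)).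
      destruct (F x). unfold Re, Im in *. simpl in *. nra. }
  pose (Q := fun x => (s x * (x - Cconj b) ^ n * / (RtoC 2 - F x))%C).
  assert (forall x, 0 < Im x -> taylor 3 Q x) as TQ.
  { intros x Hx. unfold Q. destruct (HF x Hx) as [TF _].
    apply taylor_mult; [apply taylor_mult|].
    - destruct (excluded_middle_informative (x = b)) as [->|Hne].
      + exact Hs.
      + apply (taylor_factor 3 F (fun y => ((y - b) ^ n)%C)).
        * assumption.
        * apply Cpow_nz, Cminus_neq_0, Hne.
        * apply taylor_S, TF.
        * apply taylor_shift_pow.
    - apply taylor_shift_pow.
    - apply (taylor_inv 3 (fun x => (RtoC 2 - F x)%C)); [apply H2F, Hx|].
      apply taylor_minus; [apply taylor_const|assumption]. }
  assert (forall x, 0 < Im x -> Cmod (x - b) ^ n * Cmod (Q x) * Cmod (RtoC 2 - F x)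
            = Cmod (F x) * Cmod (x - Cconj b) ^ n) as HQF.
  { intros x Hx. rewrite <- !Cmod_pow, <- !Cmod_mult. f_equal.
    unfold Q. rewrite HFs. field. rewrite <- HFs. apply H2F, Hx. }
  enough (Cmod (Q z) <= 1) as H1.
  { rewrite <- HQF by assumption. apply Rmult_le_compat_r; [apply Cmod_ge_0|].
    rewrite <- (Rmult_1_r (Cmod (z - b) ^ n)) at 2.
    apply Rmult_le_compat_l; [apply pow_le, Cmod_ge_0|assumption]. }
  assert (0 < Cmod (z - Cconj b)) as Hzb.
  { eapply Rle_lt_trans; [apply Cmod_ge_0|apply (Cmod_reflect_lt _ _ Hz Hb)]. }
  assert (forall r, 0 < r < 1 -> Cmod (z - b) <= r * Cmod (z - Cconj b) ->
            Cmod (Q z) <= / r ^ n) as Hr.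
  { intros r Hr Hzr.
    pose (p := fun x => Cmod (x - b) - r * Cmod (x - Cconj b)).
    assert (forall x y, p y <= p x + 2 * Cmod (y - x)) as Hp.
    { intros x y. unfold p. pose proof (Cmod_dist_lipschitz b x y).
      pose proof (Cmod_dist_lipschitz (Cconj b) y x) as Hd.
      apply (Rmult_le_compat_l r) in Hd; [|lra].
      rewrite (Cmod_minus_sym x y) in Hd. pose proof (Cmod_ge_0 (y - x)). nra. }
    assert (forall x y, - p y <= - p x + 2 * Cmod (y - x)) as Hp'.
    { intros x y. specialize (Hp y x). rewrite Cmod_minus_sym in Hp. lra. }
    apply (maximum_principle (fun x => p x <= 0) Q (/ r ^ n)
             (Cmod b + r * Cmod (b - Cconj b) / (1 - r))).
    - intros x Hx. unfold p in Hx.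
      pose proof (Cmod_dist_lipschitz (Cconj b) b x) as Hd.
      apply (Rmult_le_compat_l r) in Hd; [|lra].
      assert (Cmod (x - b) <= r * Cmod (b - Cconj b) / (1 - r)) as Hxb.
      { apply Rle_div_r; [lra|]. lra. }
      replace x with (b + (x - b))%C by ring.
      eapply Rle_trans; [apply Cmod_triangle|lra].
    - intros x Hx. assert (- p x < 0) as Hx' by lra.
      eapply filter_imp; [|apply (locally_lipschitz_neg _ _ _ Hp' Hx')].
      intros y Hy. simpl in Hy. lra.
    - intros x Hx. apply TQ, (Apollonius_disc_upper r x b); unfold p in Hx; lra.
    - intros x Hx.
      assert (0 < Im x) as Hx0
        by (apply (Apollonius_disc_upper r x b); unfold p in Hx; lra).
      destruct (Rle_lt_or_eq_dec _ _ Hx) as [Hlt|Heq].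
      + left. eapply filter_imp; [|apply (locally_lipschitz_neg _ _ _ Hp Hlt)].
        intros y Hy. simpl in Hy. lra.
      + right. destruct (H2F x Hx0) as [Hne Hle].
        assert (0 < Cmod (x - Cconj b)) as Hxb.
        { eapply Rle_lt_trans; [apply Cmod_ge_0|apply (Cmod_reflect_lt _ _ Hx0 Hb)]. }
        assert (0 < Cmod (RtoC 2 - F x)) as H0 by (apply Cmod_gt_0; assumption).
        specialize (HQF x Hx0).
        replace (Cmod (x - b)) with (r * Cmod (x - Cconj b)) in HQF by (unfold p in Heq; lra).
        rewrite Rpow_mult_distr in HQF.
        pose proof (pow_lt _ n Hxb) as H3.
        pose proof (pow_lt r n ltac:(lra)) as H4.
        apply (Rmult_le_reg_l (r ^ n)); [assumption|]. rewrite Rinv_r by lra.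
        apply (Rmult_le_reg_r (Cmod (x - Cconj b) ^ n * Cmod (RtoC 2 - F x)));
          [apply Rmult_lt_0_compat; assumption|].
        apply (Rmult_le_compat_r (Cmod (x - Cconj b) ^ n)) in Hle; lra.
    - unfold p. lra. }
  enough (Cmod (Q z) - 1 <= 0) by lra.
  pose proof (Cmod_reflect_lt _ _ Hz Hb) as Hlt.
  pose (d := 1 - Cmod (z - b) / Cmod (z - Cconj b)).
  assert (d * Cmod (z - Cconj b) = Cmod (z - Cconj b) - Cmod (z - b)) as Hd
    by (unfold d; field; lra).
  assert (0 < d) as Hd0 by (unfold d; apply Rlt_0_minus, Rlt_div_l; lra).
  apply (le_0_of_le_small _ (INR n * Cmod (Q z)) (Rmin d 1)); [apply Rmin_pos; lra|].
  intros t [Ht0 Ht1].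
  pose proof (Rlt_le_trans _ _ _ Ht1 (Rmin_l _ _)) as Htd.
  pose proof (Rlt_le_trans _ _ _ Ht1 (Rmin_r _ _)) as Ht.
  specialize (Hr (1 - t) ltac:(lra) ltac:(nra)).
  pose proof (pow_1_minus_ge n t ltac:(lra)) as Hpow.
  pose proof (pow_lt (1 - t) n ltac:(lra)) as Hpos.
  apply (Rmult_le_compat_r ((1 - t) ^ n)) in Hr; [|lra]. rewrite Rinv_l in Hr by lra.
  apply (Rmult_le_compat_l (Cmod (Q z))) in Hpow; [|apply Cmod_ge_0].
  lra.
Qed.

(** * Harmonic mappings *)

(** The difference [A] of the quotients of [h1] and [h2] and the difference [B]
    of those of [g2] and [g1] satisfy [(x - z) A = conj ((x - z) B)]. Letting
    [x] tend to [z] along the real and along the imaginary direction gives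
    [A z = conj (B z)] and [A z = - conj (B z)]. *)
Lemma derive_decomposition_unique (h1 g1 h2 g2 : C -> C) (z : C) :
  taylor 3 h1 z -> taylor 3 g1 z -> taylor 3 h2 z -> taylor 3 g2 z ->
  locally z (fun x => (h1 x + Cconj (g1 x))%C = (h2 x + Cconj (g2 x))%C) ->
  C_derive h1 z = C_derive h2 z /\ C_derive g1 z = C_derive g2 z.
Proof.
  intros T1 T2 T3 T4 Heq.
  destruct (taylor_derive _ _ _ T1) as [p1 [E1 [U1 ->]]].
  destruct (taylor_derive _ _ _ T2) as [q1 [E2 [U2 ->]]].
  destruct (taylor_derive _ _ _ T3) as [p2 [E3 [U3 ->]]].
  destruct (taylor_derive _ _ _ T4) as [q2 [E4 [U4 ->]]].
  pose (A := fun x => (p1 x - p2 x)%C). pose (B := fun x => (q2 x - q1 x)%C).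
  assert (taylor 2 A z) as TA by (apply taylor_minus; assumption).
  assert (taylor 2 B z) as TB by (apply taylor_minus; assumption).
  assert (locally z (fun x => (x - z) * A x = Cconj ((x - z) * B x))%C) as HAB.
  { pose proof (locally_singleton _ _ Heq) as H0.
    revert Heq. apply filter_imp. intros x Hx.
    assert (Cconj ((x - z) * B x) =
      Cconj (g2 x) - Cconj (g1 x) - (Cconj (g2 z) - Cconj (g1 z)))%C as ->.
    { rewrite <- !Cminus_conj. f_equal. unfold B. rewrite (E2 x), (E4 x). ring. }
    replace ((x - z) * A x)%C with (h1 x - h2 x - (h1 z - h2 z))%C
      by (unfold A; rewrite (E1 x), (E3 x); ring).
    replace (h1 x)%C with (h2 x + Cconj (g2 x) - Cconj (g1 x))%C
      by (rewrite <- Hx; ring).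
    replace (h1 z)%C with (h2 z + Cconj (g2 z) - Cconj (g1 z))%C
      by (rewrite <- H0; ring).
    ring. }
  assert (forall e, 0 < e -> Cmod (A z - Cconj (B z)) <= 2 * e /\
            Cmod (A z + Cconj (B z)) <= 2 * e) as Hlim.
  { intros e He.
    destruct (proj1 (locally_Cmod _ _)
      (filter_and (F := locally z) _ _ HAB (filter_and _ _
        (taylor_continuous _ _ _ _ TA He) (taylor_continuous _ _ _ _ TB He))))
      as [d [Hd H]].
    pose (t := d / 2). assert (0 < t < d) as Ht by (unfold t; lra). clearbody t.
    assert (Cmod (RtoC t) = t) as Mt by (rewrite Cmod_R; apply Rabs_pos_eq; lra).
    assert (RtoC t <> RtoC 0) as Ht0 by (apply Cmod_gt_0; lra).
    assert (Cconj (RtoC t) = RtoC t) as Hct by (unfold Cconj, RtoC; simpl; f_equal; ring).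
    split.
    - destruct (H (z + RtoC t)%C) as [H1 [H2 H3]];
        [replace (z + RtoC t - z)%C with (RtoC t) by ring; lra|].
      set (x := (z + RtoC t)%C) in *.
      replace (x - z)%C with (RtoC t) in H1 by (unfold x; ring).
      rewrite Cmult_conj, Hct in H1. apply (f_equal (Cmult (/ RtoC t))) in H1.
      rewrite !Cmult_assoc, Cinv_l, !Cmult_1_l in H1 by assumption.
      replace (A z - Cconj (B z))%C
        with (- (A x - A z) + Cconj (B x - B z))%C
        by (rewrite Cminus_conj, <- H1; ring).
      eapply Rle_trans; [apply Cmod_triangle|]. rewrite Cmod_opp, Cmod_conj. lra.
    - destruct (H (z + Ci * RtoC t)%C) as [H1 [H2 H3]].
      { replace (z + Ci * RtoC t - z)%C with (Ci * RtoC t)%C by ring.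
        rewrite Cmod_mult, Cmod_Ci. lra. }
      set (x := (z + Ci * RtoC t)%C) in *.
      replace (x - z)%C with (Ci * RtoC t)%C in H1 by (unfold x; ring).
      assert (Cconj Ci = - Ci)%C as Hci
        by (unfold Cconj, Ci, Copp; simpl; f_equal; ring).
      assert (Ci <> RtoC 0) as Hi0 by (apply Cmod_gt_0; rewrite Cmod_Ci; lra).
      assert (A x = - Cconj (B x))%C as H1'.
      { rewrite !Cmult_conj, Hct, Hci in H1.
        apply (f_equal (Cmult (/ (Ci * RtoC t)))) in H1.
        replace (/ (Ci * RtoC t) * (Ci * RtoC t * A x))%C with (A x) in H1
          by (field; split; assumption).
        rewrite H1. field. split; assumption. }
      replace (A z + Cconj (B z))%C
        with (- (A x - A z) + - Cconj (B x - B z))%C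
        by (rewrite Cminus_conj, H1'; ring).
      eapply Rle_trans; [apply Cmod_triangle|].
      rewrite !Cmod_opp, Cmod_conj. lra. }
  assert (forall w : C, (forall e, 0 < e -> Cmod w <= 2 * e) -> w = RtoC 0) as Hz.
  { intros w Hw. apply Cmod_eq_0, Rle_antisym; [|apply Cmod_ge_0].
    apply Rnot_lt_le. intros Hpos. specialize (Hw (Cmod w / 4) ltac:(lra)). lra. }
  pose proof (Hz _ (fun e He => proj1 (Hlim e He))) as H1.
  pose proof (Hz _ (fun e He => proj2 (Hlim e He))) as H2.
  assert (A z = RtoC 0) as HA.
  { replace (A z) with (((A z - Cconj (B z)) + (A z + Cconj (B z))) * / RtoC 2)%C.
    - rewrite H1, H2. ring.
    - field. }
  assert (B z = RtoC 0) as HB.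
  { rewrite <- (Cconj_conj (B z)).
    replace (Cconj (B z)) with (A z - (A z - Cconj (B z)))%C by ring.
    rewrite H1, HA. unfold Cconj, Cminus, Cplus, Copp, RtoC. simpl. f_equal; ring. }
  unfold A, B in HA, HB. split.
  - replace (p1 z) with (p1 z - p2 z + p2 z)%C by ring. rewrite HA. ring.
  - replace (q2 z) with (q2 z - q1 z + q1 z)%C by ring. rewrite HB. ring.
Qed.

Lemma upper_half_plane_open (z : C) :
  upper_half_plane z -> locally z upper_half_plane.
Proof.
  intros Hz. apply locally_Cmod. exists (Im z). split; [exact Hz|].
  intros x Hx. unfold upper_half_plane in *.
  pose proof (Rmax_Cmod (x - z)%C) as H.
  pose proof (Rmax_r (Rabs (fst (x - z)%C)) (Rabs (snd (x - z)%C))) as H'.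
  assert (Rabs (snd (x - z)%C) < Im z) as H0 by lra.
  apply Rabs_lt_between in H0. destruct x, z. unfold Im in *. simpl in *. lra.
Qed.

Lemma pow_1_minus_le (n : nat) (x : R) :
  0 <= x <= 1 -> (1 - x) ^ n * (1 + INR n * x) <= 1.
Proof.
  intros Hx. induction n as [|n IH].
  - simpl. lra.
  - rewrite S_INR. simpl. pose proof (pos_INR n).
    pose proof (pow_le (1 - x) n ltac:(lra)) as Hp.
    assert ((1 - x) * (1 + (INR n + 1) * x) <= 1 + INR n * x) as Hs by nra.
    apply (Rmult_le_compat_l ((1 - x) ^ n)) in Hs; [|assumption]. lra.
Qed.

(** By [Cmod_sq_reflect], the square of the ratio is
    [1 - 4 Im z Im b / |z - conj b| ^ 2 <= 1 - x] with [x] proportional to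
    [Im b], and [(1 - x) ^ p <= 1 / (1 + p x)], while the right-hand side is
    [1 / (1 + 2 Im b / (10 - Im b))]. *)
Lemma reflect_ratio_pow_le (z : C) :
  0 < Im z ->
  exists p : nat, forall b : C, 0 < Im b -> Cmod b <= 1 ->
    (Cmod (z - b) / Cmod (z - Cconj b)) ^ (2 * p) <= (10 - Im b) / (10 + Im b).
Proof.
  intros Hz. pose (L := (Cmod z + 1) ^ 2).
  assert (0 < L) as HL by (apply pow_lt; pose proof (Cmod_ge_0 z); lra).
  destruct (INR_unbounded (L / Im z)) as [p Hp].
  (* [p Im z > L] gives [p x > 4 Im b], more than the [2 Im b / (10 - Im b)]
     that is needed when [Im b <= 1] *)
  exists p. intros b Hb Hb1.
  apply (Rmult_lt_compat_r (Im z)) in Hp; [|assumption].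
  replace (L / Im z * Im z) with L in Hp by (field; lra).
  pose proof (Cmod_reflect_lt z b Hz Hb) as Hlt.
  pose proof (Cmod_ge_0 (z - b)) as H0.
  pose proof (Cmod_sq_reflect z b) as Hs.
  set (u := Cmod (z - b)) in *. set (v := Cmod (z - Cconj b)) in *.
  assert (v ^ 2 <= L) as HvL.
  { unfold L. apply pow_incr. split; [lra|]. unfold v.
    eapply Rle_trans; [apply Cmod_triangle|]. rewrite Cmod_opp, Cmod_conj. lra. }
  assert (Im b <= 1) as Hb2.
  { eapply Rle_trans; [|exact Hb1].
    pose proof (Rmax_Cmod b). pose proof (Rmax_r (Rabs (fst b)) (Rabs (snd b))).
    pose proof (Rle_abs (snd b)). unfold Im. lra. }
  assert (0 < Im z * Im b) as Hzb by (apply Rmult_lt_0_compat; assumption).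
  pose (x := 4 * Im z * Im b / L).
  assert (x * L = 4 * Im z * Im b) as HxL by (unfold x; field; lra).
  assert (0 < x) as Hx0 by (apply Rdiv_lt_0_compat; lra).
  assert (x <= 1) as Hx1.
  { unfold x. apply Rle_div_l; [assumption|]. pose proof (pow2_ge_0 u). lra. }
  assert (0 < v ^ 2) as Hv2 by (apply pow_lt; lra).
  assert (0 <= (u / v) ^ 2 <= 1 - x) as Huv.
  { split; [apply pow2_ge_0|]. unfold Rdiv. rewrite Rpow_mult_distr, pow_inv.
    apply Rle_div_l; [assumption|].
    assert (x * v ^ 2 <= x * L) by (apply Rmult_le_compat_l; lra). lra. }
  rewrite pow_mult.
  apply Rle_trans with ((1 - x) ^ p); [apply pow_incr, Huv|].
  pose proof (pow_1_minus_le p x ltac:(lra)) as Hpow.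
  apply Rle_div_r; [lra|].
  pose proof (pow_le (1 - x) p ltac:(lra)) as Hpos.
  assert (4 * Im b <= INR p * x) as Hpx.
  { apply (Rmult_le_reg_r L); [assumption|].
    replace (INR p * x * L) with (INR p * (x * L)) by ring. rewrite HxL.
    nra. }
  assert (10 + Im b <= (10 - Im b) * (1 + INR p * x)) as Hfin by nra.
  apply (Rmult_le_compat_l ((1 - x) ^ p)) in Hfin; [|assumption].
  apply (Rmult_le_compat_l (10 - Im b)) in Hpow; lra.
Qed.

Definition le_order (n : nat) (mu : option nat) : Prop :=
  match mu with
  | Some m => (n <= m)%nat
  | None => True
  end.

(** In the case of infinite order the expansion of 0 serves for every [n], so
    that both kinds of zero can be treated through the finite orders [n] below
    [mu]. *)
Lemma zero_order_expansion (h : C -> C) (b : C) (mu : option nat) (n : nat) :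
  upper_half_plane b -> zero_order upper_half_plane h b mu -> le_order n mu ->
  exists a : nat -> C, has_expansion h b a /\
    forall k : nat, (k < n)%nat -> a k = RtoC 0.
Proof.
  intros Hb Hh Hn. destruct mu as [m|].
  - destruct Hh as [a [Ha [H0 _]]]. exists a. split; [assumption|].
    intros k Hk. apply H0. simpl in Hn. lia.
  - exists (fun _ => RtoC 0). split; [|reflexivity].
    destruct (proj1 (locally_Cmod _ _) (upper_half_plane_open b Hb)) as [r [Hr H]].
    exists r. split; [assumption|]. intros w Hw. rewrite (Hh w (H w Hw)).
    apply (filterlim_ext (fun _ => zero : C_NormedModule)); [|apply filterlim_const].
    intros m. symmetry. induction m as [|m IH].
    + rewrite sum_O. apply (scal_zero_r (V := C_NormedModule)).
    + rewrite sum_Sn, IH, (scal_zero_r (V := C_NormedModule)). apply plus_zero_l.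
Qed.

Lemma analytic_on_taylor (D : C -> Prop) (f : C -> C) (k : nat) (z : C) :
  analytic_on D f -> D z -> taylor k f z.
Proof. intros Hf Hz. destruct (Hf z Hz) as [a Ha]. exact (expansion_taylor _ _ _ _ Ha). Qed.

(** If [A <= B] are the two powers in [half_plane_schwarz], then
    [|F| B <= A |2 - F| <= A (2 + |F|)] gives [|F| (B - A) <= 2 A], in which
    [|F|] may be replaced by the smaller [|Re F|]. *)
Lemma half_plane_real_part_bound (F s : C -> C) (b z : C) (n : nat) :
  upper_half_plane b -> upper_half_plane z ->
  taylor 3 s b -> (forall x : C, F x = ((x - b) ^ n * s x)%C) ->
  (forall x : C, upper_half_plane x -> taylor 4 F x /\ Re (F x) < 1) ->
  Rabs (Re (F z)) <= (2 + Rabs (Re (F z))) * (Cmod (z - b) / Cmod (z - Cconj b)) ^ n.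
Proof.
  intros Hb Hz Ts HFs HF.
  pose proof (half_plane_schwarz F s b n Hb Ts HFs HF z Hz) as H.
  pose proof (Cmod_reflect_lt z b Hz Hb) as Hlt.
  pose proof (Cmod_ge_0 (z - b)) as H0.
  unfold Rdiv. rewrite Rpow_mult_distr, pow_inv.
  assert (0 < Cmod (z - Cconj b) ^ n) as HB by (apply pow_lt; lra).
  rewrite <- Rmult_assoc. apply Rle_div_r; [assumption|].
  assert (0 <= Cmod (z - b) ^ n) as HA0 by (apply pow_le; lra).
  assert (Cmod (z - b) ^ n <= Cmod (z - Cconj b) ^ n) as HAB by (apply pow_incr; lra).
  pose proof (re_le_Cmod (F z)) as HRe.
  assert (Cmod (RtoC 2 - F z) <= 2 + Cmod (F z)) as H2.
  { eapply Rle_trans; [apply Cmod_triangle|].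
    rewrite Cmod_opp, Cmod_R, Rabs_pos_eq; lra. }
  apply (Rmult_le_compat_l (Cmod (z - b) ^ n)) in H2; [|assumption].
  nra.
Qed.

(** The bound is applied to [h1 + g1] and [- i (h1 - g1)], where [h1], [g1] is
    the decomposition normalized at [b]. It inherits [|g1'| <= |h1'|] from [h],
    [g] because the derivatives do not depend on the decomposition. *)
Lemma sense_preserving_zero_bound (f h g : C -> C) (b z : C) (mu : option nat) (n : nat) :
  harmonic_decomposition upper_half_plane f h g ->
  sense_preserving upper_half_plane h g ->
  (forall x : C, upper_half_plane x -> Cmod (f x) < 1) ->
  upper_half_plane b -> multiplicity upper_half_plane f b mu -> le_order n mu ->
  upper_half_plane z ->
  let r := (Cmod (z - b) / Cmod (z - Cconj b)) ^ n in
  Rabs (Re (f z)) <= (2 + Rabs (Re (f z))) * r /\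
  Rabs (Im (f z)) <= (2 + Rabs (Im (f z))) * r.
Proof.
  intros [Ah [Ag Hf]] [w [_ [Hw Hwd]]] Hbd Hb
    [h1 [g1 [[Ah1 [Ag1 Hf1]] [_ [Hg0 Hmu]]]]] Hn Hz.
  destruct (zero_order_expansion _ _ _ _ Hb Hmu Hn) as [c [Hc Hc0]].
  destruct (Ag1 b Hb) as [d Hd].
  pose proof (upper_half_plane_open b Hb) as Hloc.
  assert (forall x, upper_half_plane x ->
            Cmod (C_derive g1 x) <= Cmod (C_derive h1 x)) as Hgh.
  { intros x Hx.
    destruct (derive_decomposition_unique h1 g1 h g x) as [-> ->];
      try (eapply analytic_on_taylor; eassumption).
    - generalize (upper_half_plane_open x Hx). apply filter_imp.
      intros y Hy. rewrite <- Hf, <- Hf1 by assumption. reflexivity.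
    - rewrite Hwd, Cmod_mult by assumption. specialize (Hw x Hx).
      pose proof (Cmod_ge_0 (C_derive h x)). nra. }
  destruct (expansion_factor h1 b c n Hc Hc0) as [t [ct [Ht Hht]]].
  destruct (zero_order_transfer h1 g1 b c d n Hc Hc0 Hd Hg0) with (m := n)
    as [s [cs [Hs Hgs]]]; try lia;
    try (generalize Hloc; apply filter_imp; intros x Hx;
         try (apply Hgh, Hx); eapply analytic_on_taylor; eassumption).
  assert (forall x, upper_half_plane x ->
            Rabs (Re (f x)) < 1 /\ Rabs (Im (f x)) < 1) as Hri.
  { intros x Hx. specialize (Hbd x Hx). pose proof (Rmax_Cmod (f x)).
    pose proof (Rmax_l (Rabs (fst (f x))) (Rabs (snd (f x)))).
    pose proof (Rmax_r (Rabs (fst (f x))) (Rabs (snd (f x)))).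
    unfold Re, Im. lra. }
  assert (forall x, upper_half_plane x -> taylor 4 h1 x /\ taylor 4 g1 x) as Thg.
  { intros x Hx. split; eapply analytic_on_taylor; eassumption. }
  pose proof (expansion_taylor 3 _ _ _ Ht) as Tt.
  pose proof (expansion_taylor 3 _ _ _ Hs) as Ts.
  assert (forall x, upper_half_plane x -> Re (h1 x + g1 x)%C = Re (f x)) as HR.
  { intros x Hx. rewrite Hf1 by assumption. destruct (h1 x), (g1 x). reflexivity. }
  assert (forall x, upper_half_plane x ->
            Re (- Ci * (h1 x - g1 x))%C = Im (f x)) as HI.
  { intros x Hx. rewrite Hf1 by assumption. destruct (h1 x), (g1 x).
    unfold Re, Im. simpl. ring. }
  split.
  - rewrite <- HR by assumption.
    apply (half_plane_real_part_bound (fun x => (h1 x + g1 x)%C) (fun x => (t x + s x)%C));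
      try assumption.
    + apply taylor_plus; assumption.
    + intros x. rewrite Hht, Hgs. ring.
    + intros x Hx. split; [apply taylor_plus; apply Thg, Hx|].
      rewrite HR by assumption. destruct (Hri x Hx) as [H _].
      apply Rabs_lt_between in H. lra.
  - rewrite <- HI by assumption.
    apply (half_plane_real_part_bound (fun x => (- Ci * (h1 x - g1 x))%C)
             (fun x => (- Ci * (t x - s x))%C));
      try assumption.
    + apply taylor_scal, taylor_minus; assumption.
    + intros x. rewrite Hht, Hgs. ring.
    + intros x Hx. split; [apply taylor_scal, taylor_minus; apply Thg, Hx|].
      rewrite HI by assumption. destruct (Hri x Hx) as [_ H].
      apply Rabs_lt_between in H. lra.
Qed.

Theorem theorem2 (f h g : C -> C) (b : nat -> C) (mu : nat -> option nat)
  (hf : harmonic_decomposition upper_half_plane f h g)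
  (hsp : sense_preserving upper_half_plane h g)
  (hbound : forall z : C, upper_half_plane z -> Cmod (f z) < 1)
  (hb : forall k : nat, upper_half_plane (b k))
  (hzero : forall k : nat, f (b k) = RtoC 0)
  (hlim : filterlim b eventually (locally (RtoC 0)))
  (hmu : forall k : nat, multiplicity upper_half_plane f (b k) (mu k))
  (hpow : is_lim_seq
     (fun k : nat =>
        extended_pow ((10 - Im (b k)) / (10 + Im (b k))) (mu k)) 0) :
  forall z : C, upper_half_plane z -> f z = RtoC 0.
Proof.
  intros z Hz.
  destruct (reflect_ratio_pow_le z Hz) as [p Hp].
  enough (forall s : R,
    (forall k n, le_order n (mu k) -> Rabs s <= (2 + Rabs s) *
       (Cmod (z - b k) / Cmod (z - Cconj (b k))) ^ n) -> s = 0) as Hs.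
  { apply injective_projections; apply Hs; intros k n Hn;
      apply (sense_preserving_zero_bound f h g (b k) z (mu k) n); auto. }
  intros s Hs. apply NNPP. intros Hne.
  pose proof (Rabs_pos_lt s Hne) as Hs0.
  (* [e] is a lower bound for the powers in [hpow] that does not depend on [k]. *)
  pose (e := (Rabs s / (2 + Rabs s)) ^ (2 * p)).
  assert (0 < e) as He by (apply pow_lt, Rdiv_lt_0_compat; lra).
  assert (locally (RtoC 0) (fun x => Cmod x <= 1)) as Hloc.
  { apply locally_Cmod. exists 1. split; [lra|]. intros x Hx.
    replace (x - RtoC 0)%C with x in Hx by ring. lra. }
  apply hlim in Hloc. change (eventually (fun k => Cmod (b k) <= 1)) in Hloc.
  apply is_lim_seq_spec in hpow. specialize (hpow (mkposreal e He)).
  destruct (filter_ex _ (filter_and _ _ Hloc hpow)) as [k [Hk1 Hk2]].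
  simpl in Hk2. rewrite Rminus_0_r in Hk2.
  pose proof (hb k) as Hbk. unfold upper_half_plane in Hbk.
  specialize (Hp (b k) Hbk Hk1).
  pose proof (Cmod_reflect_lt z (b k) Hz Hbk) as Hlt.
  pose proof (Cmod_ge_0 (z - b k)) as H0.
  set (q := (10 - Im (b k)) / (10 + Im (b k))) in *.
  set (r := Cmod (z - b k) / Cmod (z - Cconj (b k))) in *.
  assert (0 <= r) as Hr by (apply Rdiv_le_0_compat; lra).
  assert (0 <= r ^ (2 * p)) as Hr2 by (apply pow_le; assumption).
  assert (q < 1) as Hq by (unfold q; apply Rlt_div_l; lra).
  assert (forall n, le_order n (mu k) -> e <= q ^ n) as Hn.
  { intros n Hn. apply Rle_trans with ((r ^ (2 * p)) ^ n); [|apply pow_incr; lra].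
    rewrite <- pow_mult, Nat.mul_comm, pow_mult. unfold e. apply pow_incr. split.
    - apply Rdiv_le_0_compat; lra.
    - apply Rle_div_l; [lra|]. rewrite Rmult_comm. apply Hs, Hn. }
  destruct (mu k) as [m|].
  - specialize (Hn m (le_n m)). simpl in Hk2.
    pose proof (Rle_abs (q ^ m)). lra.
  - destruct (pow_lt_1_zero q ltac:(rewrite Rabs_pos_eq; lra) e He) as [N HN].
    specialize (HN N (le_n N)). specialize (Hn N I).
    pose proof (Rle_abs (q ^ N)). lra.
Qed.
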